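(* Let $(Q,* )$ and $(K,\circ)$ be (nonempty) connected quandles, and denote by $B=(Q\times K,\underline{\ast},\overline{\ast})$ their product biquandle. Then $Aut(B)\cong Aut(Q)\times Aut(K)$.
   Context: A quandle is a set $Q$ with a binary operation $*$ such that (1) $x*x=x$ for all $x$; (2) for every $y$ the map $S_y(x)=x*y$ is a bijection of $Q$; (3) $(x*y)*z=(x*z)*(y*z)$ for all $x,y,z$. $Aut(Q)$ is the group of bijective quandle homomorphisms $Q\to Q$. A quandle $(Q,* )$ is connected if for every $x,y\in Q$ there exist $z_1,\ldots,z_n\in Q$ with $y=(\cdots((x*z_1)*z_2)*\cdots)*z_n$. The product biquandle of quandles $(Q,* )$ and $(K,\circ)$ is the set $Q\times K$ with the two binary operations $(x,a)\,\underline{\ast}\,(y,b)=(x*y,a)$ and $(x,a)\,\overline{\ast}\,(y,b)=(x,a\circ b)$; $Aut(B)$ is the group of bijections of $Q\times K$ preserving both operations. *)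

(* Defs.v *)
From HB Require Import structures.
From mathcomp Require Import all_boot.
From mathcomp Require Import boolp.

Set Implicit Arguments.
Unset Strict Implicit.
Unset Printing Implicit Defensive.

HB.mixin Record isQuandle (Q : Type) := {
  qop : Q -> Q -> Q;
  qopxx : forall x, qop x x = x;
  qop_bij : forall y, bijective (fun x => qop x y);
  qopD : forall x y z, qop (qop x y) z = qop (qop x z) (qop y z)
}.

#[short(type="quandleType")]
HB.structure Definition Quandle := { Q of isQuandle Q }.

(* foldl qop x [:: z_1; ...; z_n] is (...((x * z_1) * z_2) ...) * z_n.
   Allowing n = 0 changes nothing, since x = x * x. *)
Definition qconnected (Q : quandleType) : Prop :=
  forall x y : Q, exists zs : seq Q, y = foldl qop x zs.

(* bunder is the underlined operation, bover the overlined one. *)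
HB.mixin Record isBiquandle (B : Type) := {
  bunder : B -> B -> B;
  bover : B -> B -> B;
  bopxx : forall x, bunder x x = bover x x;
  bunder_bij : forall y, bijective (fun x => bunder x y);
  bover_bij : forall y, bijective (fun x => bover x y);
  bswap_bij : bijective (fun p : B * B => (bover p.2 p.1, bunder p.1 p.2));
  bunderD : forall x y z,
    bunder (bunder x y) (bunder z y) = bunder (bunder x z) (bover y z);
  bunder_bover : forall x y z,
    bover (bunder x y) (bunder z y) = bunder (bover x z) (bover y z);
  boverD : forall x y z,
    bover (bover x y) (bover z y) = bover (bover x z) (bunder y z)
}.

#[short(type="biquandleType")]
HB.structure Definition Biquandle := { B of isBiquandle B }.

Definition prod_biquandle (Q K : quandleType) : Type := (Q * K)%type.

Section ProdBiquandle.
Variables Q K : quandleType.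
Local Notation B := (prod_biquandle Q K).
Implicit Types p q r : B.

Definition prod_under p q : B := (qop p.1 q.1, p.2).
Definition prod_over p q : B := (p.1, qop p.2 q.2).

Fact prod_opxx p : prod_under p p = prod_over p p.
Proof. by rewrite /prod_under /prod_over !qopxx. Qed.

Fact prod_under_bij q : bijective (prod_under^~ q).
Proof.
have [h hK Kh] := qop_bij q.1.
by exists (fun p : B => (h p.1, p.2)) => -[x a]; rewrite /prod_under /= ?hK ?Kh.
Qed.

Fact prod_over_bij q : bijective (prod_over^~ q).
Proof.
have [h hK Kh] := qop_bij q.2.
by exists (fun p : B => (p.1, h p.2)) => -[x a]; rewrite /prod_over /= ?hK ?Kh.
Qed.

Fact prod_swap_bij :
  bijective (fun p : B * B => (prod_over p.2 p.1, prod_under p.1 p.2)).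
Proof.
have invQ (y : Q) : {h | cancel (qop^~ y) h & cancel h (qop^~ y)}.
  by apply: cid2; case: (qop_bij y) => h; exists h.
have invK (a : K) : {h | cancel (qop^~ a) h & cancel h (qop^~ a)}.
  by apply: cid2; case: (qop_bij a) => h; exists h.
pose hQ y := s2val (invQ y); pose hK a := s2val (invK a).
have hQ1 y x : hQ y (qop x y) = x by rewrite /hQ; case: (invQ y).
have hQ2 y x : qop (hQ y x) y = x by rewrite /hQ; case: (invQ y).
have hK1 y x : hK y (qop x y) = x by rewrite /hK; case: (invK y).
have hK2 y x : qop (hK y x) y = x by rewrite /hK; case: (invK y).
exists (fun p : B * B =>
  ((hQ p.1.1 p.2.1, p.2.2) : B, (p.1.1, hK p.2.2 p.1.2) : B)).
  by move=> [[x a] [y b]]; rewrite /prod_over /prod_under /= hQ1 hK1.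
by move=> [[x a] [y b]]; rewrite /prod_over /prod_under /= hQ2 hK2.
Qed.

Fact prod_underD p q r :
  prod_under (prod_under p q) (prod_under r q) =
  prod_under (prod_under p r) (prod_over q r).
Proof. by rewrite /prod_under /= -qopD. Qed.

Fact prod_under_over p q r :
  prod_over (prod_under p q) (prod_under r q) =
  prod_under (prod_over p r) (prod_over q r).
Proof. by []. Qed.

Fact prod_overD p q r :
  prod_over (prod_over p q) (prod_over r q) =
  prod_over (prod_over p r) (prod_under q r).
Proof. by rewrite /prod_over /= -qopD. Qed.

HB.instance Definition _ := isBiquandle.Build (prod_biquandle Q K)
  prod_opxx prod_under_bij prod_over_bij prod_swap_bij
  prod_underD prod_under_over prod_overD.

End ProdBiquandle.

Section Bijections.
Variables (T : Type) (f : T -> T) (f_bij : bijective f).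

Fact inv_sig : {g : T -> T | cancel f g & cancel g f}.
Proof. by apply: cid2; case: f_bij => g; exists g. Qed.

Definition bij_inv : T -> T := s2val inv_sig.

Lemma bij_invK : cancel f bij_inv.
Proof. by rewrite /bij_inv; case: inv_sig. Qed.

Lemma bij_invVK : cancel bij_inv f.
Proof. by rewrite /bij_inv; case: inv_sig. Qed.

Lemma bij_inv_bij : bijective bij_inv.
Proof. exists f; [exact: bij_invVK | exact: bij_invK]. Qed.

Lemma bij_inv_morph (op : T -> T -> T) :
  {morph f : x y / op x y} -> {morph bij_inv : x y / op x y}.
Proof.
by move=> fM x y; apply: (can_inj bij_invK); rewrite fM !bij_invVK.
Qed.

End Bijections.

Lemma comp_morph (T : Type) (f g : T -> T) (op : T -> T -> T) :
  {morph f : x y / op x y} -> {morph g : x y / op x y} ->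
  {morph f \o g : x y / op x y}.
Proof. by move=> fM gM x y; rewrite /= gM fM. Qed.

(* The group law on automorphisms is composition: (f * g) x = f (g x). *)

Record qaut (Q : quandleType) := QAut {
  qaut_fun :> Q -> Q;
  qaut_bij : bijective qaut_fun;
  qaut_morph : {morph qaut_fun : x y / qop x y}
}.

Section QAutGroup.
Variable Q : quandleType.
Implicit Types f g h : qaut Q.

Lemma qautP f g : f =1 g -> f = g.
Proof.
case: f g => [f fB fM] [g gB gM] /= /funext fg.
by case: _ / fg in gB gM *; congr QAut; apply: Prop_irrelevance.
Qed.

Definition qaut_one : qaut Q :=
  @QAut Q id (Bijective (frefl id) (frefl id)) (fun _ _ => erefl).

Definition qaut_mul f g : qaut Q :=
  QAut (bij_comp (qaut_bij f) (qaut_bij g))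
       (comp_morph (qaut_morph f) (qaut_morph g)).

Definition qaut_inv f : qaut Q :=
  QAut (bij_inv_bij (qaut_bij f)) (bij_inv_morph (qaut_bij f) (qaut_morph f)).

Fact qaut_mulA : associative qaut_mul.
Proof. by move=> f g h; apply: qautP. Qed.
Fact qaut_mul1g : left_id qaut_one qaut_mul.
Proof. by move=> f; apply: qautP. Qed.
Fact qaut_mulg1 : right_id qaut_one qaut_mul.
Proof. by move=> f; apply: qautP. Qed.
Fact qaut_mulVg : left_inverse qaut_one qaut_inv qaut_mul.
Proof. by move=> f; apply: qautP => x; apply: bij_invK. Qed.
Fact qaut_mulgV : right_inverse qaut_one qaut_inv qaut_mul.
Proof. by move=> f; apply: qautP => x; apply: bij_invVK. Qed.

HB.instance Definition _ := gen_eqMixin (qaut Q).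
HB.instance Definition _ := gen_choiceMixin (qaut Q).
HB.instance Definition _ := isGroup.Build (qaut Q)
  qaut_mulA qaut_mul1g qaut_mulg1 qaut_mulVg qaut_mulgV.

End QAutGroup.

Record baut (B : biquandleType) := BAut {
  baut_fun :> B -> B;
  baut_bij : bijective baut_fun;
  baut_under : {morph baut_fun : x y / bunder x y};
  baut_over : {morph baut_fun : x y / bover x y}
}.

Section BAutGroup.
Variable B : biquandleType.
Implicit Types f g h : baut B.

Lemma bautP f g : f =1 g -> f = g.
Proof.
case: f g => [f fB fU fO] [g gB gU gO] /= /funext fg.
by case: _ / fg in gB gU gO *; congr BAut; apply: Prop_irrelevance.
Qed.

Definition baut_one : baut B :=
  @BAut B id (Bijective (frefl id) (frefl id))
    (fun _ _ => erefl) (fun _ _ => erefl).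

Definition baut_mul f g : baut B :=
  BAut (bij_comp (baut_bij f) (baut_bij g))
       (comp_morph (baut_under f) (baut_under g))
       (comp_morph (baut_over f) (baut_over g)).

Definition baut_inv f : baut B :=
  BAut (bij_inv_bij (baut_bij f))
       (bij_inv_morph (baut_bij f) (baut_under f))
       (bij_inv_morph (baut_bij f) (baut_over f)).

Fact baut_mulA : associative baut_mul.
Proof. by move=> f g h; apply: bautP. Qed.
Fact baut_mul1g : left_id baut_one baut_mul.
Proof. by move=> f; apply: bautP. Qed.
Fact baut_mulg1 : right_id baut_one baut_mul.
Proof. by move=> f; apply: bautP. Qed.
Fact baut_mulVg : left_inverse baut_one baut_inv baut_mul.
Proof. by move=> f; apply: bautP => x; apply: bij_invK. Qed.
Fact baut_mulgV : right_inverse baut_one baut_inv baut_mul.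
Proof. by move=> f; apply: bautP => x; apply: bij_invVK. Qed.

HB.instance Definition _ := gen_eqMixin (baut B).
HB.instance Definition _ := gen_choiceMixin (baut B).
HB.instance Definition _ := isGroup.Build (baut B)
  baut_mulA baut_mul1g baut_mulg1 baut_mulVg baut_mulgV.

End BAutGroup.

Definition group_iso (G H : groupType) : Prop :=
  exists phi : {multiplicative G -> H}, bijective phi.

(* Main.v *)
From HB Require Import structures.
Require Import Defs.
From mathcomp Require Import all_boot.

(* The second coordinate of an automorphism f of Q x K is unchanged when
   (x, a) is replaced by (x, a) under (z, a) = (x * z, a), because the operation
   under fixes second coordinates; connectedness of Q then makes it independent
   of x. Symmetrically the first coordinate depends only on the point of Q, so f
   is a product of two maps, which are automorphisms of Q and K. *)

Section ProdBiquandleAut.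
Variables Q K : quandleType.
Local Notation B := (prod_biquandle Q K).
Implicit Types (f : baut B) (x : Q) (a : K).

Lemma baut_fst_const (K_connected : qconnected K) f x a b :
  (f (x, a)).1 = (f (x, b)).1.
Proof.
have [cs ->] := K_connected a b.
elim: cs a => //= c cs IH a; rewrite -IH.
by have /= -> := baut_over f (x, a) (x, c).
Qed.

Lemma baut_snd_const (Q_connected : qconnected Q) f x y a :
  (f (x, a)).2 = (f (y, a)).2.
Proof.
have [zs ->] := Q_connected x y.
elim: zs x => //= z zs IH x; rewrite -IH.
by have /= -> := baut_under f (x, a) (z, a).
Qed.

Section Components.
Hypotheses (Q_connected : qconnected Q) (K_connected : qconnected K).
Variables (x0 : Q) (a0 : K).

(** The base points are arbitrary: by [baut_fst_const] and [baut_snd_const], any other choice gives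
    the same two components. *)
Definition baut_fst_fun f x : Q := (f (x, a0)).1.
Definition baut_snd_fun f a : K := (f (x0, a)).2.

Lemma bautE f x a : f (x, a) = (baut_fst_fun f x, baut_snd_fun f a).
Proof.
rewrite /baut_fst_fun /baut_snd_fun (baut_fst_const K_connected f x a0 a).
by rewrite (baut_snd_const Q_connected f x0 x a) -surjective_pairing.
Qed.

(** The point [g (x, a0)] need not have second coordinate [a0], but by [bautE] the first coordinate
    of its image under [f] does not depend on that. *)
Lemma baut_fst_comp f g x :
  baut_fst_fun (baut_mul f g) x = baut_fst_fun f (baut_fst_fun g x).
Proof. by rewrite {1}/baut_fst_fun /= !bautE. Qed.

Lemma baut_snd_comp f g a :
  baut_snd_fun (baut_mul f g) a = baut_snd_fun f (baut_snd_fun g a).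
Proof. by rewrite {1}/baut_snd_fun /= !bautE. Qed.

Lemma baut_fst_bij f : bijective (baut_fst_fun f).
Proof.
(* Components respect composition, and the component of the identity is the identity, so the
   component of the inverse is an inverse. *)
exists (baut_fst_fun (baut_inv f)) => x; rewrite -baut_fst_comp.
  by rewrite baut_mulVg.
by rewrite baut_mulgV.
Qed.

Lemma baut_snd_bij f : bijective (baut_snd_fun f).
Proof.
exists (baut_snd_fun (baut_inv f)) => a; rewrite -baut_snd_comp.
  by rewrite baut_mulVg.
by rewrite baut_mulgV.
Qed.

(** On the slice of points [(x, a0)], [bunder] is the operation of [Q]; on the slice of points
    [(x0, a)], [bover] is that of [K]. *)
Lemma baut_fst_morph f : {morph baut_fst_fun f : x y / qop x y}.
Proof.
by move=> x y; rewrite {1}/baut_fst_fun (baut_under f (x, a0) (y, a0)).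
Qed.

Lemma baut_snd_morph f : {morph baut_snd_fun f : a b / qop a b}.
Proof.
by move=> a b; rewrite {1}/baut_snd_fun (baut_over f (x0, a) (x0, b)).
Qed.

Definition baut_split f : qaut Q * qaut K :=
  (QAut (baut_fst_bij f) (baut_fst_morph f),
   QAut (baut_snd_bij f) (baut_snd_morph f)).

Lemma baut_splitM : {morph baut_split : f g / (f * g)%g >-> (f * g)%g}.
Proof.
move=> f g; congr pair; apply: qautP => z.
  exact: baut_fst_comp.
exact: baut_snd_comp.
Qed.

End Components.

Section Product.
Variable fg : qaut Q * qaut K.

Definition qaut_pair_fun (p : B) : B := (fg.1 p.1, fg.2 p.2).

Lemma qaut_pair_bij : bijective qaut_pair_fun.
Proof.
have [f' f'K f'VK] := qaut_bij fg.1; have [g' g'K g'VK] := qaut_bij fg.2.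
exists (fun p : B => (f' p.1, g' p.2)) => -[x a];
  by rewrite /qaut_pair_fun /= ?f'K ?g'K ?f'VK ?g'VK.
Qed.

Lemma qaut_pair_under : {morph qaut_pair_fun : p q / bunder p q}.
Proof.
by case=> x a [y b]; rewrite /qaut_pair_fun /bunder /= /prod_under qaut_morph.
Qed.

Lemma qaut_pair_over : {morph qaut_pair_fun : p q / bover p q}.
Proof.
by case=> x a [y b]; rewrite /qaut_pair_fun /bover /= /prod_over qaut_morph.
Qed.

(** This provides the inverse of [baut_split]. *)
Definition qaut_pair : baut B :=
  BAut qaut_pair_bij qaut_pair_under qaut_pair_over.

End Product.
End ProdBiquandleAut.

Theorem proposition4p4 (Q K : quandleType)
  (Q_nonempty : inhabited Q) (K_nonempty : inhabited K)
  (Q_connected : qconnected Q) (K_connected : qconnected K) :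
  group_iso (baut (prod_biquandle Q K)) (qaut Q * qaut K)%type.
Proof.
case: Q_nonempty K_nonempty => x0 [a0].
pose split := baut_split Q K Q_connected K_connected x0 a0.
have splitM : {morph split : f g / (f * g)%g >-> (f * g)%g}.
  exact: baut_splitM.
pose split_mul := isMultiplicative.Build _ _ split splitM.
pose phi : {multiplicative baut (prod_biquandle Q K) -> qaut Q * qaut K} :=
  HB.pack split split_mul.
exists phi; exists (qaut_pair Q K) => [f|[f g]].
  apply: bautP => -[x a].
  by rewrite [RHS](bautE Q K Q_connected K_connected x0 a0).
(* The components of the product map of [f] and [g] reduce to [f] and [g] by computation. *)
by congr pair; apply: qautP.
Qed.
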